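(* Let $[\beta,\lambda]$ be an interval in the dominance lattice $\mathcal{P}_n$ with atom set $\mathcal{A}$. If $\bigvee\mathcal{A}\ne\lambda$ then $\mu(\beta,\lambda)=0$. If $\bigvee\mathcal{A}=\lambda$, let $r_i$, $0\le i\le 2$, be the number of special runs of length congruent to $i$ modulo $3$. Then $$\mu(\beta,\lambda)=\begin{cases}0 & \text{if } r_1\ge 1,\\ (-1)^{|\mathcal{A}\setminus\mathcal{S}|+r_2} & \text{if } r_1=0.\end{cases}$$
   Context: $\mathcal{P}_n$ is the lattice of partitions of the integer $n$ under dominance: for partitions $\lambda=(\lambda_1\ge\lambda_2\ge\cdots)$ and $\nu$ of $n$, $\lambda\ge\nu$ iff $\sum_{i=1}^k\lambda_i\ge\sum_{i=1}^k\nu_i$ for all $k$ (parts beyond the last are $0$). $\mu(\beta,\lambda)$ is the usual two-variable Möbius function of $\mathcal{P}_n$: $\mu(\beta,\beta)=1$ and $\mu(\beta,\lambda)=-\sum_{\beta\le\nu<\lambda}\mu(\beta,\nu)$ for $\lambda>\beta$. $\bigvee$ denotes join in $[\beta,\lambda]$, the empty join being $\beta$. Fix $\beta=(\beta_1,\dots,\beta_r)\in\mathcal{P}_n$ with conventions $\beta_0=\infty$, $\beta_{k}=0$ for $k>r$. A wall is an interval $[i,j]\subseteq[1,r]$ of integers with $i<j$ and $\beta_{i-1}>\beta_i=\beta_j>\beta_{j+1}$. The elements covering $\beta$ in $\mathcal{P}_n$ are of two sorts: (i) if $1\le i<r$ and neither $i$ nor $i+1$ lies in a wall, the partition $\alpha$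 agreeing with $\beta$ except $\alpha_i=\beta_i+1$, $\alpha_{i+1}=\beta_{i+1}-1$, denoted $i+1\to i$; (ii) if $[i,j]$ is a wall, the partition $\alpha$ agreeing with $\beta$ except $\alpha_i=\beta_i+1$, $\alpha_j=\beta_j-1$, denoted $j\to i$. The critical interval of such an $\alpha$ is the set of $k$ with $\sum_{l\le k}\alpha_l\ne\sum_{l\le k}\beta_l$; it is $\{i\}$ in case (i) and $[i,j-1]$ in case (ii). Distinct covers of $\beta$ have disjoint critical intervals. $\mathcal{A}$ is the set of atoms of $[\beta,\lambda]$ (covers of $\beta$ that are $\le\lambda$). An atom in $\mathcal{A}$ of the form $k+1\to k$ is special if $\beta_k=\beta_{k+1}+1$ and $\mathcal{A}$ also contains the atoms $k+2\to k+1$ and $k\to k-1$. $\mathcal{S}\subseteq\mathcal{A}$ is the set of special atoms. List $\mathcal{A}$ according to the left-to-right order of the critical intervals. A special run is a maximal sequence $\sigma_1,\dots,\sigma_q$ of consecutive elements of this list that are all special; its length is $q$ ($q\ge1$). *)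

(* Defs.v *)
From HB Require Import structures.
From mathcomp Require Import all_boot all_order all_algebra.
From mathcomp Require Import zify.
Set Implicit Arguments.
Unset Strict Implicit.
Unset Printing Implicit Defensive.
Import Order.TTheory GRing.Theory.

Section FinPoset.
Context {disp : Order.disp_t} {T : finPOrderType disp}.
Implicit Types x y z : T.

Fixpoint mobius_rec (m : nat) x y : int :=
  if x == y then 1%R else
  if m is m'.+1 then (- \sum_(z : T | (x <= z < y)%O) mobius_rec m' x z)%R
  else 0%R.

(* The fuel #|[x, y)| bounds the depth of the recursion; [mobiusxx] and
   [mobius_lt] are the defining equations. *)
Definition mobius x y : int :=
  mobius_rec #|[pred z : T | (x <= z < y)%O]| x y.

Lemma mobius_recE m x y : #|[pred z : T | (x <= z < y)%O]| <= m ->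
  mobius_rec m x y = mobius x y.
Proof.
rewrite /mobius; move: {2}#|_|%N (leqnn #|[pred z : T | (x <= z < y)%O]|) => k.
elim: k m y => [|k IHk] m y.
  rewrite leqn0 => /eqP k0 _; rewrite k0.
  case: m => [|m] //=; case: ifP => // _.
  by rewrite big_pred0 ?oppr0 // => z; have /card0_eq/(_ z) := k0.
set c := #|_| => ck cm.
case: m cm => [|m] cm.
  by have -> : c = 0%N by apply/eqP; rewrite -leqn0.
case E: c => [|c'] //=.
  case: ifP => // _; rewrite big_pred0 ?oppr0 // => z.
  by have /card0_eq/(_ z) := E.
case: ifP => // _; congr (- _)%R; apply: eq_bigr => z /andP[xz zy].
have lt_c : #|[pred w : T | (x <= w < z)%O]| < c.
  apply: proper_card; apply/properP; split.
    apply/subsetP => w; rewrite !inE => /andP[-> wz] /=.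
    exact: lt_trans wz zy.
  by exists z; rewrite !inE ?ltxx ?andbF // xz zy.
by rewrite (IHk m) ?(IHk c') // -ltnS; apply: (leq_trans lt_c); rewrite -/c // E.
Qed.

Lemma mobiusxx x : mobius x x = 1%R.
Proof. by rewrite /mobius; case: #|_| => [|c] /=; rewrite eqxx. Qed.

Lemma mobius_lt x y : (x < y)%O ->
  mobius x y = (- \sum_(z : T | (x <= z < y)%O) mobius x z)%R.
Proof.
move=> xy; rewrite -(@mobius_recE #|[pred z : T | (x <= z < y)%O]|.+1) //=.
rewrite (lt_eqF xy); congr (- _)%R; apply: eq_bigr => z /andP[xz zy].
apply: mobius_recE; apply: subset_leq_card; apply/subsetP => w.
rewrite !inE => /andP[-> wz] /=; exact: lt_trans wz zy.
Qed.

Definition covers x y : bool := (x < y)%O && [forall z, ~~ (x < z < y)%O].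

Definition atoms x y : {set T} := [set a | covers x a && (a <= y)%O].

End FinPoset.

(* Partitions of [n] are padded with zeros to length exactly [n]. *)
Definition is_intpart (n : nat) (t : n.-tuple 'I_n.+1) : bool :=
  sorted geq [seq val i | i <- t] && (sumn [seq val i | i <- t] == n).

Record intpart (n : nat) := IntPart {
  parts : n.-tuple 'I_n.+1;
  _ : is_intpart parts }.

HB.instance Definition _ n := [isSub for @parts n].
HB.instance Definition _ n := [Finite of intpart n by <:].

(* Parts are indexed from 0: [part l k] is the (k+1)-st part, and it is 0
   past the end. *)
Definition part n (l : intpart n) (k : nat) : nat :=
  nth 0 [seq val i | i <- parts l] k.

Definition psum n (l : intpart n) (k : nat) : nat := \sum_(i < k) part l i.

Definition dominated n (l1 l2 : intpart n) : bool :=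
  [forall k : 'I_n.+1, psum l1 k <= psum l2 k].

Section IntPartTheory.
Variable n : nat.
Implicit Types l x y z : intpart n.

Lemma part_ge l k : n <= k -> part l k = 0.
Proof. by move=> nk; rewrite /part nth_default // size_map size_tuple. Qed.

Lemma part_geS l k : part l k.+1 <= part l k.
Proof.
have [kn|nk] := ltnP k.+1 n; last by rewrite part_ge.
have /andP[/(sortedP 0) + _] : is_intpart (parts l) := valP l.
by apply; rewrite size_map size_tuple.
Qed.

Lemma psum0 l : psum l 0 = 0.
Proof. by rewrite /psum big_ord0. Qed.

Lemma psumS l k : psum l k.+1 = psum l k + part l k.
Proof. by rewrite /psum big_ord_recr. Qed.

Lemma psum_size l : psum l n = n.
Proof.
have /andP[_ /eqP] : is_intpart (parts l) := valP l.
by rewrite sumnE (big_nth 0) size_map size_tuple big_mkord.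
Qed.

Lemma psum_ge l k : n <= k -> psum l k = n.
Proof.
elim: k => [|k IHk]; first by rewrite leqn0 => /eqP/esym; rewrite psum0.
rewrite leq_eqVlt => /predU1P[<-|nk]; first exact: psum_size.
by rewrite psumS IHk // part_ge // addn0.
Qed.

Lemma eq_psum x y : (forall k, psum x k = psum y k) -> x = y.
Proof.
move=> E; apply: val_inj; apply: val_inj; apply: (inj_map val_inj).
apply: (@eq_from_nth _ 0); first by rewrite !size_map !size_tuple.
move=> i _; rewrite -/(part x i) -/(part y i).
by have := E i.+1; rewrite !psumS E => /addnI.
Qed.

Lemma dominatedP x y :
  reflect (forall k, psum x k <= psum y k) (dominated x y).
Proof.
apply: (iffP forallP) => [H k|H k]; last exact: H.
have [kn|nk] := ltnP k n.+1; first exact: (H (Ordinal kn)).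
by rewrite !psum_ge // ltnW.
Qed.

Fact dominated_refl : reflexive (@dominated n).
Proof. by move=> x; apply/dominatedP. Qed.

Fact dominated_anti : antisymmetric (@dominated n).
Proof.
move=> x y /andP[/dominatedP xy /dominatedP yx]; apply: eq_psum => k.
by apply/eqP; rewrite eqn_leq xy yx.
Qed.

Fact dominated_trans : transitive (@dominated n).
Proof.
move=> y x z /dominatedP xy /dominatedP yz; apply/dominatedP => k.
exact: leq_trans (xy k) (yz k).
Qed.

Lemma intpart_of_psum (f : nat -> nat) :
  f 0 = 0 -> f n = n -> (forall k, f k <= f k.+1) ->
  (forall k, f k + f k.+2 <= f k.+1 + f k.+1) ->
  {l : intpart n | forall k, k <= n -> psum l k = f k}.
Proof.
move=> f0 fn fS fC.
have f_le k : k <= n -> f k <= n.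
  by move=> kn; rewrite -[leqRHS]fn; exact: (homo_leq leqnn leq_trans fS).
pose t : n.-tuple 'I_n.+1 := [tuple inord (f i.+1 - f i) | i < n].
have tE k : k < n -> nth 0 [seq val i | i <- t] k = f k.+1 - f k.
  move=> kn; rewrite (nth_map ord0) ?size_tuple //.
  rewrite -(tnth_nth _ _ (Ordinal kn)) tnth_mktuple /= inordK //.
  by have := f_le k.+1 kn; lia.
have sumE k : k <= n -> \sum_(i < k) nth 0 [seq val i | i <- t] i = f k.
  elim: k => [|k IHk] kn; first by rewrite big_ord0 f0.
  by rewrite big_ord_recr /= IHk ?tE //; [have := fS k; lia | exact: ltnW].
have tP : is_intpart t.
  apply/andP; split; last first.
    by rewrite sumnE (big_nth 0) size_map size_tuple big_mkord sumE // fn.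
  apply/(sortedP 0) => i; rewrite size_map size_tuple => iN.
  by rewrite /= !tE //; [have := fC i; have := fS i; lia | exact: ltnW].
by exists (IntPart tP).
Qed.

Fact dominance_top_subproof :
  {l : intpart n | forall k, k <= n -> psum l k = minn (k * n) n}.
Proof.
apply: intpart_of_psum => //; first by rewrite mul0n min0n.
- by case: (n) => // m; apply/minn_idPr; rewrite leq_pmulr.
- by move=> k; lia.
- by move=> k; case: k => [|k]; lia.
Qed.

Definition dominance_top : intpart n := sval dominance_top_subproof.

Fact dominance_lex1 x : dominated x dominance_top.
Proof.
apply/forallP => k.
rewrite (svalP dominance_top_subproof _ (leq_ord k)).
have psum_le : psum x k <= n.
  rewrite -[leqRHS](psum_size x); apply: (homo_leq leqnn leq_trans _).
    by move=> i; rewrite psumS leq_addr.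
  exact: leq_ord.
rewrite leq_min psum_le andbT.
case: (nat_of_ord k) psum_le => [|m] psum_le; first by rewrite psum0.
by rewrite (leq_trans psum_le) // leq_pmull.
Qed.

Fact dominance_meet_subproof x y :
  {l : intpart n | forall k, k <= n -> psum l k = minn (psum x k) (psum y k)}.
Proof.
apply: intpart_of_psum; rewrite ?psum0 ?psum_size ?minnn // => k.
  by rewrite !psumS; lia.
by have := part_geS x k; have := part_geS y k; rewrite !psumS; lia.
Qed.

Definition dominance_meet x y : intpart n := sval (dominance_meet_subproof x y).

Definition dominance_join x y : intpart n :=
  foldr dominance_meet dominance_top
    [seq z <- enum {: intpart n} | dominated x z && dominated y z].

Fact dominance_meetP x y z :
  dominated x (dominance_meet y z) = dominated x y && dominated x z.
Proof.
have mE k : k <= n ->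
    psum (dominance_meet y z) k = minn (psum y k) (psum z k).
  exact: svalP (dominance_meet_subproof y z) k.
apply/forallP/andP => [H|[/forallP Hy /forallP Hz] k].
  by split; apply/forallP => k; have := H k; rewrite mE ?leq_ord // leq_min => /andP[].
by rewrite mE ?leq_ord // leq_min Hy Hz.
Qed.

Fact dominance_joinP x y z :
  dominated (dominance_join x y) z = dominated x z && dominated y z.
Proof.
have glb (s : seq (intpart n)) w :
    dominated w (foldr dominance_meet dominance_top s)
      = all (dominated w) s.
  by elim: s => [|a s IHs] /=; rewrite ?dominance_lex1 // dominance_meetP IHs.
have ub w : dominated x w -> dominated y w ->
    dominated (dominance_join x y) w.
  move=> xw yw.
  have := glb [seq z <- enum {: intpart n} | dominated x z && dominated y z]
    (dominance_join x y).
  rewrite -/(dominance_join x y) dominated_refl => /esym/allP; apply.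
  by rewrite mem_filter xw yw mem_enum.
have xj : dominated x (dominance_join x y).
  by rewrite glb; apply/allP => w; rewrite mem_filter => /andP[/andP[]].
have yj : dominated y (dominance_join x y).
  by rewrite glb; apply/allP => w; rewrite mem_filter => /andP[/andP[]].
apply/idP/andP => [jz|[xz yz]]; last exact: ub.
by split; apply: dominated_trans jz.
Qed.

End IntPartTheory.

Fact dominance_display : Order.disp_t. Proof. exact: Order.Disp tt tt. Qed.

HB.instance Definition _ n :=
  Order.Le_isPOrder.Build dominance_display (intpart n)
    (@dominated_refl n) (@dominated_anti n) (@dominated_trans n).
HB.instance Definition _ n :=
  Order.POrder_MeetJoin_isLattice.Build dominance_display (intpart n)
    (@dominance_meetP n) (@dominance_joinP n).

Section SpecialRuns.
Variables (n : nat) (beta lambda : intpart n).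
Implicit Types a : intpart n.

(* [a] agrees with [beta] except that part [i] has been increased by 1 and part
   [j] decreased by 1.  When [a] covers [beta], this says that [a] is the cover
   denoted j -> i. *)
Definition moves (j i : nat) a : bool :=
  (i < j) && [forall k : 'I_n, part a k + (k == j :> nat)
                               == part beta k + (k == i :> nat)].

(* [k] is the leftmost index involved, so that indices stay nonnegative: the
   special atom is k+2 -> k+1. *)
Definition special_atoms : {set intpart n} :=
  [set a in atoms beta lambda |
    [exists k : 'I_n,
      [&& moves k.+2 k.+1 a,
          part beta k.+1 == (part beta k.+2).+1,
          [exists b in atoms beta lambda, moves k.+3 k.+2 b]
        & [exists c in atoms beta lambda, moves k.+1 k c]]]].

Definition critical a : {set 'I_n.+1} :=
  [set k : 'I_n.+1 | psum a k != psum beta k].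

Definition critical_left a : nat := find (mem (critical a)) (enum 'I_n.+1).

(* Distinct atoms have disjoint critical intervals, so comparing the left
   endpoints lists the atoms from left to right. *)
Definition atom_list : seq (intpart n) :=
  sort (fun a b => critical_left a <= critical_left b)
       (enum (atoms beta lambda)).

Definition special_at (i : nat) : bool :=
  (i < size atom_list) && (nth beta atom_list i \in special_atoms).

(* The entries of [atom_list] at the positions i, ..., j - 1 form a nonempty
   maximal block of special atoms. *)
Definition special_run (i j : nat) : bool :=
  [&& i < j, [forall k : 'I_j, (i <= k) ==> special_at k],
      ~~ special_at j & (0 < i) ==> ~~ special_at i.-1].

Definition nb_special_runs (m : nat) : nat :=
  let N := (size atom_list).+1 in
  #|[set ij : 'I_N * 'I_N | special_run ij.1 ij.2 & (ij.2 - ij.1) %% 3 == m]|.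

End SpecialRuns.

(* Main.v *)
Require Import Defs.
From mathcomp Require Import all_boot all_order all_algebra.
From mathcomp Require Import zify.
Set Implicit Arguments.
Unset Strict Implicit.
Unset Printing Implicit Defensive.
Import Order.TTheory GRing.Theory.

(** Identify a partition with its sequence of partial sums, a concave function
    of the index; dominance is the pointwise order on these functions.  By
    Rota's crosscut theorem ([crosscut]), the Moebius function of an interval
    [beta, lambda] is the sum of [(-1) ^+ #|X|] over the sets [X] of covers of
    [beta] whose join is [lambda].  Such an [X] consists of atoms, so there is
    none at all unless the join of all atoms is [lambda].

    When the atoms do join to [lambda], the question is which atoms may be left
    out of [X].  Covers of [beta] raise the partial sums by 1 on pairwise
    disjoint intervals ([cover_exchange], [exchange_disjoint]).  Concavity
    recovers an omitted atom from its two neighbours exactly in the special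
    situation: if the graph of [beta] bends by 1 at a point and both adjacent
    points are raised, then the point itself has to be raised
    ([exchange_le_gap]).  In every other situation the omitted atom is not below
    the join ([joins_ge_exchange]): there is a line supporting the graph of
    [beta] that touches it on a segment meeting the critical interval of the
    omitted atom and where no atom of [X] raises it, and the partitions under
    that line include [X] and have a greatest element ([psum_joins_segment]).  So
    the join of [X] is [lambda] iff every omitted atom is special and no two
    consecutive atoms are omitted ([joins_eq_omission]).

    It remains to evaluate the alternating sum of these [X] along the list of
    atoms.  It factors: a nonspecial atom contributes -1, and a special run of
    length q contributes the signed count of the independent sets of a path with
    q vertices, which satisfies p(q+2) = - p(q+1) - p(q) and so runs through
    1, 0, -1 periodically.  Hence a run of length 1 modulo 3 kills the sum and a
    run of length 2 modulo 3 changes its sign ([transfer_recurrence],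
    [omission_sumE]). *)

(** * Alternating sums over subsets and the crosscut theorem *)

Section AlternatingSums.
Local Open Scope ring_scope.
Variable T : finType.
Implicit Types (a : T) (B X : {set T}).

Lemma sum_subsetU1 a B (P : pred {set T}) (F : {set T} -> int) : a \notin B ->
  \sum_(X : {set T} | (X \subset a |: B) && P X) F X =
  \sum_(X : {set T} | (X \subset B) && P (a |: X)) F (a |: X)
  + \sum_(X : {set T} | (X \subset B) && P X) F X.
Proof.
move=> aB; have sub_notin X : X \subset B -> a \notin X.
  by move=> XB; apply: contra aB; apply: (subsetP XB).
rewrite (bigID (fun X => a \in X)) /=; congr (_ + _).
  rewrite (reindex_onto (fun X => a |: X) (fun X => X :\ a)) /=; last first.
    by move=> X /andP[_ aX]; rewrite setD1K.
  apply: eq_bigl => X; rewrite setU11 andbT.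
  have -> : ((a |: X) :\ a == X) = (a \notin X).
    apply/eqP/idP => [<-|aX]; first by rewrite !inE eqxx.
    by rewrite setU1K.
  apply/idP/idP => [/andP[/andP[XB ->] aX]|/andP[XB ->]].
    rewrite andbT; apply/subsetP => x xX.
    have := subsetP XB x; rewrite !inE xX orbT => /(_ isT).
    by case/predU1P => // xa; rewrite -xa xX in aX.
  by rewrite sub_notin // setUS.
apply: eq_bigl => X; apply/idP/idP => [/andP[/andP[XB ->] aX]|/andP[XB ->]].
  rewrite andbT; apply/subsetP => x xX.
  have := subsetP XB x xX; rewrite !inE.
  by case/predU1P => // xa; rewrite -xa xX in aX.
by rewrite sub_notin // (subset_trans XB) // subsetU1.
Qed.

Lemma sum_sign_subset B :
  \sum_(X : {set T} | X \subset B) (-1) ^+ #|X| = (B == set0)%:R :> int.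
Proof.
have [->|/set0Pn[a aB]] := eqVneq.
  by rewrite (big_pred1 set0) ?cards0 // => X; rewrite subset0.
rewrite (eq_bigl (fun X => (X \subset a |: (B :\ a)) && xpredT X)); last first.
  by move=> X; rewrite setD1K ?andbT.
rewrite (sum_subsetU1 xpredT) ?inE ?eqxx // -big_split /=.
apply: big1 => X; rewrite andbT => XB.
have aX : a \notin X.
  by apply: contraL XB => aX; apply/subsetPn; exists a; rewrite // !inE eqxx.
by rewrite cardsU1 aX exprS mulN1r addNr.
Qed.

End AlternatingSums.

Section CrosscutTheorem.
Local Open Scope ring_scope.
Context {disp : Order.disp_t} {T : finLatticeType disp}.
Implicit Types (x y z a : T) (X : {set T}).

Lemma joins_from_le x X z :
  (\big[Order.join/x]_(a in X) a <= z)%O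
  = (x <= z)%O && [forall a in X, (a <= z)%O].
Proof.
rewrite -big_enum /=.
have -> : [forall a in X, (a <= z)%O] = all (fun a => (a <= z)%O) (enum X).
  apply/forall_inP/allP => H a; first by rewrite mem_enum; apply: H.
  by rewrite -mem_enum; apply: H.
elim: (enum X) => [|a s IHs]; first by rewrite big_nil andbT.
by rewrite big_cons leUx IHs /= andbCA.
Qed.

(** Minimality in the finite set ]x, y] is measured by the size of the down-set,
    which makes any minimizer a cover of [x]. *)
Lemma exists_atom x y : (x < y)%O -> exists a, a \in atoms x y.
Proof.
move=> xy; pose Q z := (x < z <= y)%O.
have Qy : Q y by rewrite /Q xy lexx.
case: (arg_minnP (fun z => #|[pred w | (w <= z)%O]|) Qy) => a /andP[xa ay] amin.
exists a; rewrite inE /covers xa ay andbT /=.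
apply/forallP => z; apply/negP => /andP[xz za].
have := amin z; rewrite /Q xz (le_trans (ltW za) ay) => /(_ isT).
rewrite leqNgt => /negP[]; apply: proper_card; apply/properP; split.
  by apply/subsetP => w; rewrite !inE => /le_trans; apply; exact: ltW.
by exists a; rewrite !inE ?lexx // lt_geF.
Qed.

(** The right-hand side, as a function of [y], satisfies the recursion defining
    the Moebius function: summed over [x <= z <= y] it counts, with sign, all the
    subsets of [atoms x y], and this vanishes as soon as there is an atom, that
    is as soon as [x < y]. *)
Theorem crosscut x y : (x <= y)%O ->
  mobius x y =
  \sum_(X : {set T} | (X \subset [set a | covers x a])
                      && (\big[Order.join/x]_(a in X) a == y)) (-1) ^+ #|X|.
Proof.
set J := fun X => \big[Order.join/x]_(a in X) a.
pose g z := \sum_(X : {set T} | (X \subset [set a | covers x a]) && (J X == z))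
  (-1) ^+ #|X| : int.
have sum_g y' : (x <= y')%O ->
    \sum_(z | (x <= z <= y')%O) g z = (x == y')%:R.
  move=> xy; transitivity ((atoms x y' == set0)%:R : int); last first.
    congr (nat_of_bool _)%:R; apply/eqP/eqP => [A0|<-].
      apply/eqP; apply: contraT => nxy.
      have /exists_atom[a] : (x < y')%O by rewrite lt_neqAle nxy.
      by rewrite A0 inE.
    apply/setP => a; rewrite !inE; apply/negP => /andP[/andP[/lt_le_trans + _]].
    by move=> H /H; rewrite ltxx.
  rewrite -sum_sign_subset; symmetry.
  rewrite (partition_big J (fun z => (x <= z <= y')%O)) /=; last first.
    move=> X XA; have : (J X <= J X)%O by [].
    rewrite {1}joins_from_le => /andP[-> _]; rewrite joins_from_le xy /=.
    apply/forall_inP => a aX; have := subsetP XA a aX.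
    by rewrite inE => /andP[].
  apply: eq_bigr => z /andP[xz zy]; apply: eq_bigl => X.
  case: eqP => [Jz|]; rewrite ?andbF // !andbT; apply/idP/idP => /subsetP XA.
    by apply/subsetP => a /XA; rewrite !inE => /andP[].
  apply/subsetP => a aX; have := XA a aX; rewrite !inE => ->.
  apply: le_trans zy; move: (lexx z); rewrite -{1}Jz joins_from_le.
  by case/andP=> _ /forall_inP; apply.
move=> xy; rewrite -/(g y).
have [k le_k] := ubnP #|[pred z : T | (x <= z < y)%O]|.
elim: k y xy le_k => // k IHk y xy le_k.
have := sum_g _ xy; rewrite (bigD1 y) ?xy ?lexx //=.
have -> : \sum_(z | (x <= z <= y)%O && (z != y)) g z =
          \sum_(z | (x <= z < y)%O) mobius x z.
  apply: eq_big => [z|z]; first by rewrite lt_neqAle -andbA (andbC (z != y)).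
  rewrite -andbA => /and3P[xz zy nzy]; rewrite IHk //.
  have ltzy : (z < y)%O by rewrite lt_neqAle nzy.
  rewrite -ltnS (leq_trans _ le_k) // ltnS; apply: proper_card.
  apply/properP; split.
    by apply/subsetP => w; rewrite !inE => /andP[-> wz] /=; apply: lt_trans ltzy.
  by exists z; rewrite !inE ?ltxx ?andbF // xz ltzy.
have [<-|nxy] := eqVneq x y.
  by rewrite mobiusxx big_pred0 ?addr0 // => z; rewrite le_lt_asym.
have ltxy : (x < y)%O by rewrite lt_neqAle nxy.
by rewrite mobius_lt // => /eqP; rewrite addr_eq0 => /eqP.
Qed.

End CrosscutTheorem.

(** * Covers and joins of covers in the dominance lattice *)

Section Dominance.
Local Open Scope ring_scope.
Variables (n : nat) (b : intpart n).
Implicit Types (a c d x z : intpart n) (X : {set intpart n}) (p q k m s : nat).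

Lemma leP_psum x z :
  reflect (forall k, (psum x k <= psum z k)%N) (x <= z)%O.
Proof. exact: dominatedP. Qed.

Lemma part_le x i j : (i <= j)%N -> (part x j <= part x i)%N.
Proof.
elim: j => [|j IHj]; first by rewrite leqn0 => /eqP->.
rewrite leq_eqVlt => /predU1P[->//|ij].
exact: leq_trans (part_geS x j) (IHj ij).
Qed.

(** The positions between which a cover of [b] transfers one box, from part [q]
    to part [p].  Either the two parts are adjacent and unequal or they are the
    two ends of a wall.  Parts are indexed from 0, so that the critical interval
    in terms of partial sums is [p+1 .. q]. *)
Definition exchange_shape p q : bool :=
  [&& (p < q)%N, (p == 0%N) || (part b p < part b p.-1)%N,
      (part b q.+1 < part b q)%N
    & ((q == p.+1) && (part b q < part b p)%N) || (part b p == part b q)].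

Definition exchange p q a : Prop :=
  exchange_shape p q /\ forall k, psum a k = (psum b k + (p < k <= q))%N.

Lemma exchange_shape_lt p q : exchange_shape p q -> (q < n)%N.
Proof.
case/and4P=> _ _ qdesc _; rewrite ltnNge; apply/negP => nq.
by rewrite (part_ge _ nq) in qdesc.
Qed.

(** Raising the concave function [psum b] on [p+1 .. q] can only break concavity
    just outside this interval, at [p] and [q+1], and there the strict descents
    of [b] leave room. *)
Lemma exchange_exists p q : exchange_shape p q -> exists a, exchange p q a.
Proof.
move=> pq; have qn := exchange_shape_lt pq.
case/and4P: (pq) => lt_pq pdesc qdesc _.
pose f k := (psum b k + (p < k <= q))%N.
have [a aE] : {l : intpart n | forall k, (k <= n)%N -> psum l k = f k}.
  apply: intpart_of_psum; rewrite /f.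
  - by rewrite psum0 ltn0.
  - by rewrite psum_size (leqNgt n) qn andbF addn0.
  - by move=> k; rewrite psumS; have [->|?] := eqVneq k q; lia.
  - move=> k; rewrite !psumS; have := part_geS b k.
    have [kp|?] := eqVneq k.+1 p; first by rewrite -kp /= in pdesc *; lia.
    by have [->|?] := eqVneq k q; lia.
exists a; split=> // k; have [|nk] := leqP k n; first exact: aE.
by rewrite !psum_ge ?(ltnW nk) // (leqNgt k) (ltn_trans qn nk) andbF addn0.
Qed.

Lemma block_end i j : (i <= j)%N -> (part b j.+1 < part b j)%N ->
  exists2 e, (i <= e <= j)%N & (part b e.+1 < part b e)%N /\ part b e = part b i.
Proof.
move=> ij jdesc.
have [|e /andP[ie edesc] emin] :=
    @ex_minnP (fun e => (i <= e)%N && (part b e.+1 < part b e)%N).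
  by exists j; rewrite ij.
exists e; first by rewrite ie emin // ij.
split=> //; have: forall k, (i <= k <= e)%N -> part b k = part b i.
  elim=> [|k IHk]; first by rewrite leqn0 => /andP[/eqP->].
  case: (ltngtP i k.+1) => [ik|//|->//] ke /=; rewrite -IHk; last by lia.
  apply/eqP; rewrite eqn_leq part_geS leqNgt; apply/negP => kdesc.
  by have := emin k; rewrite kdesc andbT -ltnS ik => /(_ isT); lia.
by apply; rewrite ie leqnn.
Qed.

(** On the first maximal interval [p+1 .. Q] where [psum a] exceeds [psum b], the
    parts of [b] descend strictly just before [p] and just after [Q].  If part [p]
    starts a wall, that wall ends by [Q] and is the required exchange.
    Otherwise part [p+1] either is alone in its block, and the exchange is
    p+1 -> p, or it starts a wall, which again ends by [Q]. *)
Lemma exchange_below a : (b < a)%O ->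
  exists p q, exchange_shape p q /\
    forall k, (psum b k + (p < k <= q) <= psum a k)%N.
Proof.
move=> lt_ba; have /leP_psum le_ba := ltW lt_ba.
have neq : exists k, (psum b k < psum a k)%N.
  case: (pickP (fun k : 'I_n.+1 => (psum b k < psum a k)%N)) => [k ?|eq_ba].
    by exists k.
  case/eqP: (lt_eqF lt_ba); apply: eq_psum => k; apply/eqP.
  have [kn|nk] := ltnP k n.+1; last by rewrite !psum_ge ?(ltnW nk).
  by rewrite eqn_leq le_ba leqNgt; have /= -> := eq_ba (Ordinal kn).
case: (ex_minnP neq) => [[|p] ltp pmin]; first by rewrite !psum0 in ltp.
have eq_p k : (k <= p)%N -> psum a k = psum b k.
  move=> kp; apply/eqP; rewrite eqn_leq le_ba andbT leqNgt.
  by apply/negP => /pmin; lia.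
have [|[|Q] /andP[ltpQ /eqP eqQ] Qmin] :=
    @ex_minnP (fun k => (p < k)%N && (psum a k == psum b k)).
- exists n; rewrite !psum_size eqxx andbT ltnNge; apply/negP => np.
  by have nS := leqW np; rewrite !(psum_ge _ nS) ltnn in ltp.
- by [].
have gtQ k : (p < k <= Q)%N -> (psum b k < psum a k)%N.
  move=> kpQ; rewrite ltn_neqAle le_ba andbT eq_sym; apply/negP => eqk.
  by have := Qmin k; rewrite eqk; lia.
have pQ : (p < Q)%N.
  rewrite ltnS in ltpQ; rewrite ltn_neqAle ltpQ andbT; apply/eqP => pQ.
  by rewrite pQ eqQ ltnn in ltp.
have Qdesc : (part b Q.+1 < part b Q)%N.
  have := gtQ Q; have := le_ba Q.+2; have := part_geS a Q.
  by have := eqQ; rewrite !psumS; lia.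
have pdesc : (p == 0%N) || (part b p < part b p.-1)%N.
  case: (p) eq_p ltp => // r eq_r; rewrite !psumS -!addnA /=.
  have := eq_r r.+1 (leqnn _); have := eq_r r (leqnSn _); rewrite psumS.
  have := part_geS a r; have := psumS b r.
  by lia.
have wit p' q' : (p <= p')%N -> (q' <= Q)%N -> forall k,
    (psum b k + (p' < k <= q') <= psum a k)%N.
  move=> pp' qQ k; have := le_ba k; have := gtQ k.
  by case: (boolP (p' < k <= q')%N); lia.
have := part_geS b p; rewrite leq_eqVlt => /predU1P[flat|desc].
  have [e /andP[pe eQ] [edesc eqe]] := block_end (ltnW pQ) Qdesc.
  exists p, e; split; last exact: wit.
  rewrite /exchange_shape pdesc edesc eqe eqxx orbT !andbT.
  by rewrite ltn_neqAle pe andbT; apply/eqP => pE; rewrite -pE flat ltnn in edesc.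
have [e /andP[pe eQ] [edesc eqe]] := block_end pQ Qdesc.
have [ep|nep] := eqVneq e p.+1.
  exists p, e; split; last exact: wit.
  by rewrite /exchange_shape pdesc edesc ep eqxx desc ltnSn.
exists p.+1, e; split; last exact: wit.
rewrite /exchange_shape desc edesc eqe eqxx !orbT !andbT.
by rewrite ltn_neqAle pe eq_sym nep.
Qed.

Lemma cover_exchange a : covers b a -> exists p q, exchange p q a.
Proof.
case/andP=> lt_ba /forallP no_mid.
have [p [q [pq below]]] := exchange_below lt_ba.
have [c [_ cE]] := exchange_exists pq.
have le_ca : (c <= a)%O by apply/leP_psum => k; rewrite cE.
have lt_bc : (b < c)%O.
  rewrite lt_neqAle; apply/andP; split; last first.
    by apply/leP_psum => k; rewrite cE leq_addr.
  case/and4P: pq => lt_pq _ _ _; apply/eqP => bc.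
  by have := cE p.+1; rewrite -bc; lia.
exists p, q; split=> // k; rewrite -cE; congr psum; apply/esym/eqP.
apply: contraT => nca.
by have := no_mid c; rewrite lt_bc lt_neqAle nca le_ca.
Qed.

Lemma exchange_disjoint p q p' q' k : exchange_shape p q ->
  exchange_shape p' q' -> (p < k <= q)%N -> (p' < k <= q')%N ->
  p = p' /\ q = q'.
Proof.
wlog le_pp' : p q p' q' / (p <= p')%N => [hw|].
  move=> A B kA kB; case: (leqP p p') => [/hw|/ltnW/hw]; first exact.
  by case/(_ _ _ B A kB kA).
case/and4P=> pq pdesc qdesc pq_type /and4P[pq' pdesc' qdesc' pq_type'] kA kB.
have mono i j : (i <= j)%N -> (part b j <= part b i)%N := @part_le b i j.
have eq_p : p = p'.
  apply/eqP; rewrite eqn_leq le_pp' leqNgt; apply/negP => lt_pp'.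
  have {}pq_type : part b p = part b q by case/orP: pq_type => [|/eqP//]; lia.
  have := mono p p'.-1; have := mono p' q; lia.
split=> //; move: eq_p pq' pdesc' pq_type' kB {le_pp'} => <- pq' _ pq_type' _.
have mq : (part b q <= part b p.+1)%N by apply: mono.
have mq' : (part b q' <= part b p.+1)%N by apply: mono.
have [lt_qq'|lt_qq'|//] := ltngtP q q'.
  by have := mono q.+1 q'; have := mono p q; lia.
by have := mono q'.+1 q; have := mono p q'; lia.
Qed.

(** The hypotheses on [part b] say that the line of slope [s] supporting the
    concave graph of [psum b] touches it exactly on [m0 .. m1].  Away from this
    segment the graph stays at least 1 below the line, by integrality, so that
    members of [X] remain under the line even where they exceed [b].  The
    partitions under the line have a greatest element [z], which bounds the join. *)
Lemma psum_joins_segment X s m0 m1 :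
  {in X, forall x, covers b x} -> (m0 <= m1)%N ->
  (forall k, (k < m0)%N -> (s < part b k)%N) ->
  (forall k, (m0 <= k < m1)%N -> part b k = s) ->
  (forall k, (m1 <= k)%N -> (part b k < s)%N) ->
  (forall x k, x \in X -> (m0 <= k <= m1)%N -> psum x k = psum b k) ->
  forall k, (m0 <= k <= m1)%N ->
    (psum (\big[Order.join/b]_(x in X) x) k <= psum b k)%N.
Proof.
move=> Xcov m01 before on after Xeq.
have left (d : nat) : (d <= m0)%N ->
    (psum b (m0 - d) + d + s * m0 <= psum b m0 + s * (m0 - d))%N.
  elim: d => [|d IHd] dm; first by rewrite subn0 addn0.
  have := IHd (ltnW dm); have := before (m0 - d.+1)%N.
  have -> : (m0 - d = (m0 - d.+1).+1)%N by lia.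
  by rewrite psumS mulnS; lia.
have middle (d : nat) : (m0 + d <= m1)%N ->
    psum b (m0 + d) = (psum b m0 + s * d)%N.
  elim: d => [|d IHd] dm; first by rewrite muln0 !addn0.
  by rewrite addnS psumS IHd ?on ?mulnS; lia.
have right (d : nat) : (psum b (m1 + d) + d <= psum b m1 + s * d)%N.
  elim: d => [|d IHd]; first by rewrite muln0 !addn0.
  by have := after (m1 + d)%N; rewrite !addnS psumS mulnS; lia.
have sm0 : (s * m0 <= psum b m0)%N.
  by have := left m0 (leqnn _); rewrite subnn psum0 muln0; lia.
pose line k := (s * k + (psum b m0 - s * m0))%N.
(* The truncated subtraction in [line] is exact because of [sm0]: the line is
   still nonnegative at 0. *)
have line_in k : (m0 <= k <= m1)%N -> line k = psum b k.
  move=> /andP[mk km]; have := middle (k - m0)%N; rewrite subnKC // => -> //.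
  by rewrite /line mulnBr; have := leq_mul (leqnn s) mk; lia.
have line_out k : ~~ (m0 <= k <= m1)%N -> (psum b k < line k)%N.
  rewrite negb_and -!ltnNge => /orP[km|mk].
    have := left (m0 - k)%N (leq_subr _ _); rewrite subKn ?(ltnW km) //.
    by rewrite /line; lia.
  have := right (k - m1)%N; rewrite subnKC ?(ltnW mk) // -(line_in m1); last first.
    by rewrite m01 leqnn.
  by rewrite /line mulnBr; have := leq_mul (leqnn s) (ltnW mk); lia.
have line_ge k : (psum b k <= line k)%N.
  by case: (boolP (m0 <= k <= m1)%N) => [/line_in->//|/line_out/ltnW].
(* The minimum with the top partition truncates the line to total [n]. *)
have [z zE] : {l : intpart n |
    forall k, (k <= n)%N -> psum l k = minn (psum (dominance_top n) k) (line k)}.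
  apply: intpart_of_psum.
  - by rewrite psum0 min0n.
  - by rewrite psum_size; have := line_ge n; rewrite psum_size; lia.
  - by move=> k; rewrite psumS /line mulnS; lia.
  - move=> k; rewrite !psumS /line !mulnS.
    by have := part_geS (dominance_top n) k; lia.
have le_z x : (forall k, (psum x k <= line k)%N) -> (x <= z)%O.
  move=> xline; apply/leP_psum => k; have [kn|nk] := leqP k n; last first.
    by rewrite !psum_ge ?(ltnW nk).
  rewrite zE // leq_min xline andbT.
  exact: (elimT (dominatedP x _) (dominance_lex1 x)).
have : (\big[Order.join/b]_(x in X) x <= z)%O.
  rewrite joins_from_le le_z //=; apply/forall_inP => x xX; apply: le_z => k.
  have [kin|/line_out] := boolP (m0 <= k <= m1)%N.
    by rewrite (Xeq x k) ?line_in.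
  have [p [q [_ ->]]] := cover_exchange (Xcov _ xX).
  by lia.
move/leP_psum=> Jz k kin.
have [kn|nk] := leqP k n; last by rewrite !psum_ge ?(ltnW nk).
by apply: leq_trans (Jz k) _; rewrite zE // line_in // geq_minr.
Qed.

Lemma exchange_inj p q a c : exchange p q a -> exchange p q c -> a = c.
Proof. by move=> [_ aE] [_ cE]; apply: eq_psum => k; rewrite aE cE. Qed.

(** Each conclusion is obtained by exhibiting, if it failed, a supporting line
    that separates [a] from [X].  For a wall the line runs along the wall; when
    the bend of [b] at [q] is at least 2 it touches only there; when the bend is 1
    it has the slope of one of the two adjacent edges, and the contact segment
    shows that [X] must raise the point at the other end of this edge. *)
Lemma joins_ge_exchange X a p q : {in X, forall x, covers b x} ->
  exchange p q a -> a \notin X -> (a <= \big[Order.join/b]_(x in X) x)%O ->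
  [/\ (0 < p)%N, q = p.+1, part b p = (part b q).+1,
      exists2 c, c \in X & exchange p.-1 p c
    & exists2 d, d \in X & exchange q q.+1 d].
Proof.
move=> Xcov [pq aE] aX /leP_psum/(_ p.+1).
set J := \big[_/_]_(_ in _) _; rewrite aE ltnSn /= => JE.
case/and4P: (pq) => lt_pq pdesc qdesc pq_type.
rewrite lt_pq addn1 in JE.
have mono i j : (i <= j)%N -> (part b j <= part b i)%N := @part_le b i j.
have off x k : x \in X -> (p < k <= q)%N -> psum x k = psum b k.
  move=> xX kpq; have [p' [q' [pq' xE]]] := cover_exchange (Xcov x xX).
  rewrite xE; case: (boolP (p' < k <= q')%N) => [kpq'|]; last by rewrite addn0.
  have [pp' qq'] := exchange_disjoint pq pq' kpq kpq'; subst p' q'.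
  by case/negP: aX; rewrite (_ : a = x) //; apply: (@exchange_inj p q); split.
have no_segment s m0 m1 : (m0 <= p.+1 <= m1)%N ->
  (forall k, (k < m0)%N -> (s < part b k)%N) ->
  (forall k, (m0 <= k < m1)%N -> part b k = s) ->
  (forall k, (m1 <= k)%N -> (part b k < s)%N) ->
  exists2 x, x \in X & exists2 k, (m0 <= k <= m1)%N & psum x k != psum b k.
- move=> m01 before on after.
  case: (boolP [exists x in X, [exists k : 'I_m1.+1,
                    (m0 <= k)%N && (psum x k != psum b k)]]).
    case/exists_inP=> x xX /existsP[k /andP[mk xk]]; exists x => //.
    by exists k => //; rewrite mk -ltnS ltn_ord.
  rewrite negb_exists_in => /forall_inP none.
  move: JE; rewrite ltnNge => /negP[].
  apply: (psum_joins_segment Xcov _ before on after _ m01); first by lia.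
  move=> x k xX /andP[mk km]; have := none x xX; rewrite negb_exists.
  move/forallP/(_ (Ordinal (km : (k < m1.+1)%N))); rewrite /= mk /=.
  by rewrite negbK => /eqP.
have [flat|nflat] := eqVneq (part b p) (part b q).
  have [] := no_segment (part b p) p q.+1.
  - by lia.
  - by move=> k kp; have := mono k p.-1; lia.
  - by move=> k ?; have := mono k q; have := mono p k; lia.
  - by move=> k ?; have := mono q.+1 k; lia.
  move=> x xX [k kpq]; have [p' [q' [pq' xE]]] := cover_exchange (Xcov x xX).
  have: (k == p) || (k == q.+1) || (p < k <= q)%N by lia.
  case/orP => [kE|kin]; last by rewrite (off x) ?eqxx.
  rewrite xE; case: (boolP (p' < k <= q')%N) => [kpq'|_]; last first.
    by rewrite addn0 eqxx.
  case/and4P: pq' => lt_pq' pdesc' qdesc' pq_type' _.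
  case/orP: kE => /eqP kE.
    have := mono p' p.-1; have := mono p q'; have := mono q'.+1 q.
    by case/orP: pq_type'; lia.
  have := mono p' q; have := mono q.+1 q'; have := mono p p'.-1.
  by case/orP: pq_type'; lia.
have [qp desc] : q = p.+1 /\ (part b q < part b p)%N.
  by case/orP: pq_type => [/andP[/eqP]|/eqP] //; move/eqP: nflat.
subst q; have step : part b p = (part b p.+1).+1.
  apply/eqP; rewrite eqn_leq desc andbT leqNgt; apply/negP => gap.
  have [] := no_segment (part b p.+1).+1 p.+1 p.+1.
  - by rewrite leqnn.
  - by move=> k kp; have := mono k p; lia.
  - by move=> k; lia.
  - by move=> k kp; have := mono p.+1 k; lia.
  by move=> x xX [k kp]; rewrite (off x k) ?eqxx //; lia.
have [c cX [k kp ck]] : exists2 x, x \in X &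
    exists2 k, (p <= k <= p.+1)%N & psum x k != psum b k.
  apply: (no_segment (part b p)).
  - by lia.
  - by move=> k kp; have := mono k p.-1; lia.
  - by move=> k ?; congr part; lia.
  - by move=> k kp; have := mono p.+1 k; lia.
have {kp} kp : k = p.
  apply/eqP; apply: contraNT ck => nkp; rewrite (off c) ?eqxx //; lia.
subst k.
have [d dX [k kp dk]] : exists2 x, x \in X &
    exists2 k, (p.+1 <= k <= p.+2)%N & psum x k != psum b k.
  apply: (no_segment (part b p.+1)).
  - by lia.
  - by move=> k kp; have := mono k p; lia.
  - by move=> k ?; congr part; lia.
  - by move=> k kp; have := mono p.+2 k; lia.
have {kp} kp : k = p.+2.
  apply/eqP; apply: contraNT dk => nkp; rewrite (off d) ?eqxx //; lia.
subst k.
have p_gt0 : (0 < p)%N by case: (p) ck => //; rewrite !psum0.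
split=> //.
  exists c => //; have [p' [q' [pq' cE]]] := cover_exchange (Xcov c cX).
  suff [<- <-] : p' = p.-1 /\ q' = p by split.
  have := off c p.+1 cX; have := cE p.+1; have := cE p; move/eqP: ck.
  case/and4P: pq' => lt_pq' pdesc' qdesc' pq_type'.
  have := mono p' p.-1; have := mono p q'.
  by case/orP: pq_type'; lia.
exists d => //; have [p' [q' [pq' dE]]] := cover_exchange (Xcov d dX).
suff [<- <-] : p' = p.+1 /\ q' = p.+2 by split.
have := off d p.+1 dX; have := dE p.+1; have := dE p.+2; move/eqP: dk.
case/and4P: pq' => lt_pq' pdesc' qdesc' pq_type'.
have := mono p.+2 q'; have := mono p' p.+1.
by case/orP: pq_type'; lia.
Qed.

(** Concavity of [psum z] at [p+2]: the values on both sides exceed those of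
    [psum b] by at least 1, and [psum b] bends there by exactly 1. *)
Lemma exchange_le_gap p a c d z : (b <= z)%O ->
  exchange p.+1 p.+2 a -> part b p.+1 = (part b p.+2).+1 ->
  exchange p p.+1 c -> exchange p.+2 p.+3 d ->
  (c <= z)%O -> (d <= z)%O -> (a <= z)%O.
Proof.
move=> /leP_psum bz [_ aE] step [_ cE] [_ dE] /leP_psum cz /leP_psum dz.
apply/leP_psum => k; rewrite aE; have := bz k.
case: (boolP (p.+1 < k <= p.+2)%N) => [kp _|]; last by rewrite addn0.
have -> : k = p.+2 by lia.
have := cz p.+1; have := dz p.+3; rewrite cE dE.
by have := part_geS z p.+1; rewrite !psumS; lia.
Qed.

Lemma critical_left_exchange a p q : exchange p q a -> critical_left b a = p.+1.
Proof.
move=> [pq aE]; have qn := exchange_shape_lt pq.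
have [lt_pq _ _ _] := and4P pq.
pose P k := psum a k != psum b k.
have -> : critical_left b a = find P (iota 0 n.+1).
  rewrite -val_enum_ord find_map; apply: eq_find => k /=.
  by rewrite inE.
have -> : (n.+1 = p.+1 + (n - p.+1).+1)%N by lia.
rewrite iotaD find_cat add0n size_iota.
have -> : has P (iota 0 p.+1) = false.
  apply/hasPn => k; rewrite mem_iota => kp; rewrite /P negbK aE; apply/eqP.
  by lia.
have Pp : P p.+1 by rewrite /P aE; lia.
by rewrite /= Pp addn0.
Qed.

Lemma moves_exchange p q a : covers b a -> moves b q p a <-> exchange p q a.
Proof.
move=> cov; split=> [/andP[lt_pq /forallP mv]|[pq aE]]; last first.
  case/and4P: (pq) => lt_pq _ _ _; rewrite /moves lt_pq; apply/forallP => k.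
  by have := aE k; have := aE k.+1; rewrite !psumS; lia.
have psum_mv k : (k <= n)%N ->
    (psum a k + (q < k) = psum b k + (p < k))%N.
  elim: k => [|k IHk] kn; first by rewrite !psum0.
  have := IHk (ltnW kn); have := eqP (mv (Ordinal kn)).
  by rewrite !psumS /=; lia.
have [p' [q' [pq' aE]]] := cover_exchange cov.
have qn := exchange_shape_lt pq'; have [lt_pq' _ _ _] := and4P pq'.
suff [<- <-] : p' = p /\ q' = q by split.
have H k : (k <= n)%N -> ((p' < k <= q') + (q < k) = (p < k))%N.
  by move=> /psum_mv; rewrite aE; lia.
have := H p'.+1; have := H q'.+1; have := H p.+1; have := H q'.
by lia.
Qed.

End Dominance.

(** * Runs of a predicate and a transfer recurrence *)

Section Runs.
Local Open Scope ring_scope.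
Variable P : pred nat.
Implicit Types (i j k m N : nat).

(** The number of consecutive indices satisfying [P] immediately before [j]. *)
Fixpoint trailing j : nat :=
  if j is j'.+1 then if P j' then (trailing j').+1 else 0 else 0.

(** For [0 < m] this counts the maximal runs of [P] of length [m] modulo 3 by the
    position [j < N] at which they stop: a run that stops at [j] has length
    [trailing j], and an index [j] outside [P] where no run stops has
    [trailing j = 0]. *)
Definition runs_before m N : nat :=
  \sum_(j < N) (~~ P j && (trailing j %% 3 == m)).

Lemma trailing_le j : (trailing j <= j)%N.
Proof. by elim: j => //= j IHj; case: ifP. Qed.

Lemma trailingP i j : (i <= j)%N ->
  [forall k : 'I_j, (i <= k)%N ==> P k] && ((0 < i)%N ==> ~~ P i.-1)
  = (i == (j - trailing j)%N).
Proof.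
elim: j => [|j IHj].
  by rewrite leqn0 => /eqP->; apply/andP; split=> //; apply/forallP => -[].
rewrite leq_eqVlt => /predU1P[->|ij].
  have -> : [forall k : 'I_j.+1, (j.+1 <= k)%N ==> P k].
    by apply/forallP => k; rewrite leqNgt ltn_ord.
  by rewrite /=; case: (P j) => /=; have := trailing_le j; lia.
have -> : [forall k : 'I_j.+1, (i <= k)%N ==> P k]
          = P j && [forall k : 'I_j, (i <= k)%N ==> P k].
  apply/forallP/andP => [H|[Pj /forallP H] k].
    split; first by have := H ord_max; rewrite -ltnS ij.
    by apply/forallP => k; apply: (H (widen_ord (leqnSn j) k)).
  apply/implyP => ik; have := ltn_ord k; rewrite ltnS leq_eqVlt.
  by case/predU1P => [->//|kj]; have := H (Ordinal kj); rewrite ik.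
rewrite -andbA IHj // /=; case: (P j) => /=; first by rewrite subSS.
by rewrite subn0 ltn_eqF.
Qed.

(** A maximal run is determined by its end [j], since it starts at
    [j - trailing j]. *)
Lemma card_runs m N : (0 < m)%N ->
  #|[set ij : 'I_N * 'I_N |
      [&& ij.1 < ij.2, [forall k : 'I_ij.2, (ij.1 <= k) ==> P k],
          ~~ P ij.2 & (0 < ij.1) ==> ~~ P ij.1.-1]%N
      & ((ij.2 - ij.1) %% 3 == m)%N]| = runs_before m N.
Proof.
move=> m_gt0; pose Q (i j : 'I_N) := [&& ~~ P j, (trailing j %% 3 == m)%N
  & (i == j - trailing j :> nat)%N].
rewrite -sum1dep_card.
rewrite (eq_bigl (fun ij => true && Q ij.1 ij.2)); last first.
  case=> i j; rewrite /= /Q.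
  have [ij|ji] := ltnP i j; last first.
    apply/esym/negP => /and3P[_ /eqP tm /eqP iE].
    have /eqP t0 : trailing j == 0%N by have := trailing_le j; lia.
    by rewrite t0 mod0n in tm; rewrite -tm in m_gt0.
  rewrite -!andbA; case: (P j) => /=; first by rewrite !andbF.
  rewrite andbA (trailingP (ltnW ij)) andbC.
  have [->|_] := eqVneq (i : nat) (j - trailing j)%N; last by rewrite !andbF.
  by rewrite subKn ?trailing_le // ?andbT.
rewrite -(pair_big_dep xpredT Q (fun _ _ => 1%N)) /= (exchange_big_dep xpredT) //=.
apply: eq_bigr => j _; rewrite /Q.
case: (boolP (~~ P j && _)) => [/andP[-> ->]|nQ] /=; last first.
  by rewrite big_pred0 // => i; rewrite andbA (negPf nQ).
by rewrite (big_pred1 (Ordinal (leq_ltn_trans (leq_subr (trailing j) j) (ltn_ord j)))).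
Qed.

Definition signed_value (r1 r2 f : nat) : int :=
  if (0 < r1)%N then 0 else (-1) ^+ (f + r2).

(** The sum of (-1)^(t - #|Z|) over the independent sets Z of a path with t
    vertices. *)
Definition path_sum (t : nat) : int := nth 0 [:: 1; 0; -1] (t %% 3).
(** The same sum restricted to the Z that avoid the last vertex. *)
Definition pinned_path_sum (t : nat) : int := nth 0 [:: 1; -1; 0] (t %% 3).

Lemma path_sumS t : path_sum t.+1 = - path_sum t + pinned_path_sum t.
Proof.
rewrite /path_sum /pinned_path_sum -addn1 -modnDml.
by case: (t %% 3)%N (ltn_pmod t (isT : 0 < 3)%N) => [|[|[|]]].
Qed.

Lemma pinned_path_sumS t : pinned_path_sum t.+1 = - path_sum t.
Proof.
rewrite /path_sum /pinned_path_sum -addn1 -modnDml.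
by case: (t %% 3)%N (ltn_pmod t (isT : 0 < 3)%N) => [|[|[|]]].
Qed.

Let value j f := signed_value (runs_before 1 j) (runs_before 2 j) f.

Lemma value_end_run j f : ~~ P j ->
  value j f * path_sum (trailing j) = value j.+1 f.
Proof.
move=> Pj; rewrite /value /signed_value /runs_before !big_ord_recr /= Pj /=.
rewrite /path_sum.
case: (trailing j %% 3)%N (ltn_pmod (trailing j) (isT : 0 < 3)%N) => [|[|[|]]] //= _.
- by rewrite mulr1 !addn0.
- by rewrite mulr0 addn1.
- by rewrite !addn0 addnA addn1 exprSr; case: ifP => // _; rewrite mul0r.
Qed.

Lemma value_skip j f : P j -> value j.+1 f = value j f.
Proof.
by move=> Pj; rewrite /value /runs_before !big_ord_recr /= Pj /= !addn0.
Qed.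

Lemma value_neg j f : value j f.+1 = - value j f.
Proof.
by rewrite /value /signed_value; case: ifP; rewrite ?oppr0 // addSn exprS mulN1r.
Qed.

(** Here [a j] stands for the signed sum over the admissible subsets of the first
    [j] items, and [z j] for the part of it where item [j-1] is kept: a new item
    is either kept, which changes the sign, or omitted, which requires [P] and
    that the previous item be kept. *)
Lemma transfer_recurrence (a z : nat -> int) N :
  a 0 = 1 -> z 0 = 1 ->
  (forall j, (j < N)%N -> a j.+1 = - a j + (if P j then z j else 0)) ->
  (forall j, (j < N)%N -> z j.+1 = - a j) ->
  ~~ P N ->
  a N = signed_value (runs_before 1 N.+1) (runs_before 2 N.+1)
          (\sum_(j < N) ~~ P j).
Proof.
move=> a0 z0 aS zS PN; pose f j := (\sum_(i < j) ~~ P i)%N.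
suff [aE _] : a N = value N (f N) * path_sum (trailing N) /\
              z N = value N (f N) * pinned_path_sum (trailing N).
  by rewrite aE value_end_run.
(* Completed runs are recorded in [value], the current run in [path_sum]. *)
elim: {-2}N (leqnn N) => [|j IHj] jN.
  by rewrite a0 z0 /f /value /signed_value /runs_before !big_ord0.
have [aE zE] := IHj (ltnW jN); rewrite aS // zS // aE zE.
have fS : f j.+1 = (~~ P j + f j)%N by rewrite /f big_ord_recr addnC.
rewrite fS /=; case: ifP => Pj /=.
  by rewrite value_skip // path_sumS pinned_path_sumS mulrDr mulrN.
by rewrite add1n value_neg addr0 !mulr1 value_end_run ?Pj.
Qed.

End Runs.

(** * Signed sums over the sublists with isolated omissions *)

Section OmissionSums.
Local Open Scope ring_scope.
Variables (T : finType) (x0 : T) (L : seq T) (P : pred nat).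
Hypothesis uniqL : uniq L.
Implicit Types (X : {set T}) (i j : nat).

Definition omission_ok X i : bool :=
  (nth x0 L i \in X) || P i && ((0 < i)%N ==> (nth x0 L i.-1 \in X)).

Definition omission_sum j (Q : pred {set T}) : int :=
  \sum_(X : {set T} | (X \subset [set x in take j L])
                      && (all (omission_ok X) (iota 0 j) && Q X)) (-1) ^+ #|X|.

Definition pinned_at j X : bool := (0 < j)%N ==> (nth x0 L j.-1 \in X).

Lemma omission_sum0 (Q : pred {set T}) : Q set0 -> omission_sum 0 Q = 1.
Proof.
move=> Q0; rewrite /omission_sum (big_pred1 set0) ?cards0 // => X.
rewrite take0 /= -[RHS]andbT.
have -> : [set x : T in [::]] = set0 by apply/setP => x; rewrite !inE.
by rewrite subset0; case: eqP => // ->.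
Qed.

Lemma notin_take j X : (j < size L)%N -> X \subset [set y in take j L] ->
  nth x0 L j \notin X.
Proof.
move=> jL /subsetP XB; apply/negP => /XB; rewrite inE => /(nthP x0)[i].
rewrite size_take jL => ij; rewrite nth_take // => /eqP.
by rewrite nth_uniq ?(ltn_trans ij) // ltn_eqF.
Qed.

Lemma omission_sumS j (Q : pred {set T}) : (j < size L)%N ->
  omission_sum j.+1 Q =
  - omission_sum j (fun X => Q (nth x0 L j |: X))
  + (if P j then omission_sum j (fun X => pinned_at j X && Q X) else 0).
Proof.
move=> jL; set x := nth x0 L j.
have notin i : (i < j)%N -> (nth x0 L i == x) = false.
  by move=> ij; rewrite nth_uniq ?(ltn_trans ij) // ltn_eqF.
rewrite {1}/omission_sum.
have -> : [set y in take j.+1 L] = x |: [set y in take j L].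
  by apply/setP => y; rewrite !inE (take_nth x0) // mem_rcons inE.
have out X := @notin_take j X jL.
rewrite (sum_subsetU1 (fun X => all (omission_ok X) (iota 0 j.+1) && Q X)) ?out //.
congr (_ + _).
  rewrite /omission_sum -sumrN; apply: eq_big => [X|X /andP[XB _]].
    rewrite -addn1 iotaD all_cat /= add0n andbT.
    rewrite /omission_ok -/x setU11 /= andbT; congr (_ && (_ && _)).
    apply: eq_in_all => i; rewrite mem_iota add0n /= => ij.
    rewrite !inE notin //; congr (_ || _ && _).
    by case: i ij => //= i ij; rewrite notin // ltnW.
  by rewrite cardsU1 out // exprS mulN1r.
case: ifP => Pj; last first.
  rewrite big_pred0 // => X; apply/negP => /and3P[XB + _].
  rewrite -addn1 iotaD all_cat /= add0n andbT /omission_ok -/x Pj orbF.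
  by rewrite (negPf (out X XB)) andbF.
apply: eq_bigl => X; case XB: (X \subset _); rewrite ?andFb // !andTb.
rewrite -addn1 iotaD all_cat /= add0n andbT {2}/omission_ok -/x Pj.
by rewrite (negPf (out X XB)) /= andbA.
Qed.

Lemma omission_sumE : ~~ P (size L) ->
  \sum_(X : {set T} | (X \subset [set x in L])
                      && all (omission_ok X) (iota 0 (size L))) (-1) ^+ #|X|
  = signed_value (runs_before P 1 (size L).+1) (runs_before P 2 (size L).+1)
      (\sum_(j < size L) ~~ P j).
Proof.
move=> PL; pose a j := omission_sum j xpredT.
have -> : \sum_(X : {set T} | (X \subset [set x in L])
    && all (omission_ok X) (iota 0 (size L))) (-1) ^+ #|X| = a (size L).
  by apply: eq_bigl => X; rewrite take_size andbT.
apply: (@transfer_recurrence P a (fun j => omission_sum j (pinned_at j))) => //.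
- exact: omission_sum0.
- exact: omission_sum0.
- move=> j jL; rewrite /a omission_sumS //; congr (_ + _); case: ifP => // _.
  by apply: eq_bigl => X; rewrite andbT.
- move=> j jL; rewrite omission_sumS // /a.
  have -> : omission_sum j (fun X => pinned_at j X && pinned_at j.+1 X) = 0.
    apply: big_pred0 => X; apply/negP => /and4P[XB _ _].
    by rewrite /pinned_at /= (negPf (notin_take jL XB)).
  rewrite if_same addr0; congr (- _); apply: eq_bigl => X.
  by rewrite /pinned_at /= setU11.
Qed.

End OmissionSums.

(** * Special atoms *)

Section SpecialAtoms.
Local Open Scope ring_scope.
Variables (n : nat) (b l : intpart n).
Implicit Types (a c d : intpart n) (X : {set intpart n}) (p q i : nat).

Local Notation A := (atoms b l).
Local Notation S := (special_atoms b l).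
Local Notation L := (atom_list b l).
Local Notation joins X := (\big[Order.join/b]_(x in X) x).

Lemma atoms_covers a : a \in A -> covers b a.
Proof. by rewrite inE => /andP[]. Qed.

Lemma atoms_le a : a \in A -> (a <= l)%O.
Proof. by rewrite inE => /andP[]. Qed.

Lemma special_atomP a p q : a \in A -> exchange b p q a ->
  a \in S <->
  [/\ (0 < p)%N, q = p.+1, part b p = (part b q).+1,
      exists2 c, c \in A & exchange b p.-1 p c
    & exists2 d, d \in A & exchange b q q.+1 d].
Proof.
move=> aA pqa; rewrite inE aA /=; split.
  case/existsP=> k /and4P[mv /eqP step /exists_inP[d dA mvd] /exists_inP[c cA mvc]].
  have [[-> ->]] : p = k.+1 /\ q = k.+2.
    have [pq' _] := (moves_exchange k.+1 k.+2 (atoms_covers aA)).1 mv.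
    case: (moves_exchange k.+1 k.+2 (atoms_covers aA)).1 => // _ aE'.
    case: pqa => pq aE; have [lt_pq _ _ _] := and4P pq.
    apply: (exchange_disjoint pq pq' (k := p.+1)); first by lia.
    by have := aE p.+1; rewrite aE'; lia.
  split=> //; first by exists c => //; apply/moves_exchange; rewrite ?atoms_covers.
  by exists d => //; apply/moves_exchange; rewrite ?atoms_covers.
case=> p_gt0 qp step [c cA pc] [d dA qd]; subst q.
have pn : (p.-1 < n)%N.
  by have := exchange_shape_lt (proj1 pqa); lia.
apply/existsP; exists (Ordinal pn) => /=; rewrite prednK //.
apply/and4P; split.
- exact/(moves_exchange _ _ (atoms_covers aA)).
- exact/eqP.
- by apply/exists_inP; exists d => //; apply/moves_exchange; rewrite ?atoms_covers.
- by apply/exists_inP; exists c => //; apply/moves_exchange; rewrite ?atoms_covers.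
Qed.

Lemma mem_atom_list a : (a \in L) = (a \in A).
Proof. by rewrite mem_sort mem_enum. Qed.

Lemma atom_list_uniq : uniq L.
Proof. by rewrite sort_uniq enum_uniq. Qed.

Lemma critical_left_inj : {in A &, injective (critical_left b)}.
Proof.
move=> a c aA cA; have [p [q pqa]] := cover_exchange (atoms_covers aA).
have [p' [q' pqc]] := cover_exchange (atoms_covers cA).
rewrite (critical_left_exchange pqa) (critical_left_exchange pqc) => -[pp'].
have [lt_pq _ _ _] := and4P (proj1 pqa); have [lt_pq' _ _ _] := and4P (proj1 pqc).
have [] := exchange_disjoint (k := p.+1) (proj1 pqa) (proj1 pqc); [lia|lia|].
by move=> pE qE; subst p' q'; apply: exchange_inj pqa pqc.
Qed.

(** The critical left ends increase strictly along the list, so no atom fits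
    between two whose left ends are consecutive integers. *)
Lemma index_critical_leftS a d : a \in A -> d \in A ->
  critical_left b d = (critical_left b a).+1 -> index d L = (index a L).+1.
Proof.
move=> aA dA cl_da; pose s := [seq critical_left b x | x <- L].
have s_sorted : sorted ltn s.
  rewrite ltn_sorted_uniq_leq map_inj_in_uniq ?atom_list_uniq /=; last first.
    by move=> x y; rewrite !mem_atom_list; apply: critical_left_inj.
  by rewrite sorted_map; apply: sort_sorted => x y; apply: leq_total.
have idx x : x \in A -> (index x L < size s)%N /\
    nth 0%N s (index x L) = critical_left b x.
  move=> xA; rewrite size_map index_mem mem_atom_list; split=> //.
  by rewrite (nth_map b) ?index_mem ?mem_atom_list // nth_index ?mem_atom_list.
have [ia na] := idx a aA; have [id nd] := idx d dA.
have mono := sorted_ltn_nth ltn_trans 0%N s_sorted.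
have monoE i j : (i < size s)%N -> (j < size s)%N ->
    (nth 0%N s i < nth 0%N s j)%N = (i < j)%N.
  move=> si sj; apply/idP/idP => [|ij]; last exact: mono.
  apply: contraTT; rewrite -!leqNgt leq_eqVlt => /predU1P[->//|ji].
  by apply: ltnW; apply: mono.
have lt_ad : (index a L < index d L)%N by rewrite -monoE // na nd cl_da.
apply/eqP; rewrite eqn_leq lt_ad andbT leqNgt; apply/negP => gap.
have si : ((index a L).+1 < size s)%N by apply: ltn_trans id.
have := monoE (index a L) (index a L).+1 ia si.
have := monoE (index a L).+1 (index d L) si id.
by rewrite gap ltnSn na nd cl_da; lia.
Qed.

Lemma joins_subset_le X z : (b <= z)%O -> {in X, forall x, (x <= z)%O} ->
  (joins X <= z)%O.
Proof. by move=> bz Xz; rewrite joins_from_le bz; apply/forall_inP. Qed.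

Lemma le_joins X : (b <= joins X)%O /\ {in X, forall x, (x <= joins X)%O}.
Proof.
have : (joins X <= joins X)%O by [].
by rewrite {1}joins_from_le => /andP[-> /forall_inP].
Qed.

(** The two neighbours whose presence makes an atom special are the entries just
    before and just after it in the list of atoms, hence the requirement that
    neighbours of an omitted atom be kept is the absence of two consecutive
    omissions. *)
Lemma joins_eq_omission X : (b <= l)%O -> joins A = l -> X \subset A ->
  (joins X == l) =
  all (omission_ok b L (special_at b l) X) (iota 0 (size L)).
Proof.
move=> bl joinA /subsetP XA.
have XC : {in X, forall x, covers b x} by move=> x /XA/atoms_covers.
apply/eqP/allP => [joinX i|ok].
  rewrite mem_iota add0n /= => iL; set a := nth b L i.
  have aA : a \in A by rewrite -mem_atom_list mem_nth.
  rewrite /omission_ok -/a; case aX: (a \in X) => //=.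
  have [p [q pqa]] := cover_exchange (atoms_covers aA).
  have := joins_ge_exchange XC pqa (negbT aX); rewrite joinX atoms_le //.
  case=> // p_gt0 qp step [c cX pc] [d dX qd].
  apply/andP; split.
    rewrite /special_at iL; apply/(special_atomP aA pqa); split=> //.
      by exists c => //; apply: XA.
    by exists d => //; apply: XA.
  have cl : critical_left b a = (critical_left b c).+1.
    by rewrite (critical_left_exchange pqa) (critical_left_exchange pc) prednK.
  have := index_critical_leftS (XA c cX) aA cl.
  rewrite index_uniq ?atom_list_uniq // => ->; apply/implyP => _ /=.
  by rewrite nth_index // mem_atom_list XA.
have [bJ XJ] := le_joins X; apply/le_anti.
rewrite joins_subset_le //=; last by move=> x /XA/atoms_le.
rewrite -joinA; apply: joins_subset_le => // a aA.
have [/XJ //|aX] := boolP (a \in X).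
have ok_at x : x \in A -> omission_ok b L (special_at b l) X (index x L).
  by move=> xA; apply: ok; rewrite mem_iota add0n /= index_mem mem_atom_list.
have nthA x : x \in A -> nth b L (index x L) = x.
  by move=> xA; rewrite nth_index // mem_atom_list.
have := ok_at a aA; rewrite /omission_ok nthA // (negPf aX) /=.
rewrite /special_at index_mem mem_atom_list aA nthA //= => /andP[aS prevX].
have [p [q pqa]] := cover_exchange (atoms_covers aA).
have [p_gt0 qp step [c cA pc] [d dA qd]] := (special_atomP aA pqa).1 aS.
have cl_ac : critical_left b a = (critical_left b c).+1.
  by rewrite (critical_left_exchange pqa) (critical_left_exchange pc) prednK.
have cl_da : critical_left b d = (critical_left b a).+1.
  by rewrite (critical_left_exchange pqa) (critical_left_exchange qd) qp.
have cX : c \in X.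
  by move: prevX; rewrite (index_critical_leftS cA aA cl_ac) /= nthA.
have dX : d \in X.
  have := ok_at d dA; rewrite /omission_ok nthA // => /orP[//|/andP[_]].
  by rewrite (index_critical_leftS aA dA cl_da) /= nthA // (negPf aX).
subst q; case: p p_gt0 pqa step pc qd => // p _ pqa step pc qd.
exact: (exchange_le_gap bJ pqa step pc qd (XJ c cX) (XJ d dX)).
Qed.

Lemma nonspecial_count : (\sum_(j < size L) ~~ special_at b l j)%N = #|A :\: S|.
Proof.
transitivity (\sum_(a <- L) (a \notin S : nat))%N.
  rewrite (big_nth b) big_mkord; apply: eq_bigr => j _.
  by rewrite /special_at ltn_ord.
rewrite (perm_big (enum A)) ?perm_sort //= big_enum /= -sum1_card.
rewrite big_mkcond [RHS]big_mkcond /=.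
by apply: eq_bigr => a _; rewrite in_setD; case: (a \in S); case: (a \in A).
Qed.

End SpecialAtoms.

Theorem corollary5p2 (n : nat) (beta lambda : intpart n) :
  (beta <= lambda)%O ->
  let A := atoms beta lambda in
  let S := special_atoms beta lambda in
  (* the join of the atoms in [beta, lambda]; the empty join is beta *)
  let joinA := \big[Order.join/beta]_(a in A) a in
  let r := nb_special_runs beta lambda in
  (joinA <> lambda -> mobius beta lambda = 0%R) /\
  (joinA = lambda ->
    mobius beta lambda =
      if 1 <= r 1 then 0%R else ((-1) ^+ (#|A :\: S| + r 2)%N)%R).
Proof.
move=> bl A S joinA r; rewrite crosscut //.
have sub_atoms (X : {set intpart n}) : X \subset [set a | covers beta a] ->
    \big[Order.join/beta]_(x in X) x = lambda -> X \subset A.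
  move=> /subsetP XC joinX; apply/subsetP => x xX; rewrite inE.
  by have := XC x xX; rewrite inE => -> /=; rewrite -joinX (le_joins beta X).2.
split=> [joinA_neq|joinA_eq].
  apply: big_pred0 => X; apply/negP => /andP[XC /eqP joinX].
  have /subsetP XA := sub_atoms X XC joinX; case: joinA_neq; apply/le_anti.
  have [bJ AJ] := le_joins beta A.
  rewrite joins_subset_le //=; last by move=> x /atoms_le.
  by rewrite -joinX; apply: joins_subset_le => // x /XA/AJ.
have runsE m : (0 < m)%N ->
    r m = runs_before (special_at beta lambda) m (size (atom_list beta lambda)).+1.
  exact: card_runs.
rewrite !runsE //.
rewrite -nonspecial_count -/(signed_value _ _ _).
rewrite -(@omission_sumE _ beta) ?atom_list_uniq //; last by rewrite /special_at ltnn.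
apply: eq_bigl => X.
have -> : [set x in atom_list beta lambda] = A.
  by apply/setP => x; rewrite inE mem_atom_list.
case XA: (X \subset A) => /=.
  rewrite joins_eq_omission // (_ : X \subset _) //.
  by apply/subsetP => x /(subsetP XA)/atoms_covers; rewrite inE.
apply/negP => /andP[XC /eqP joinX].
by rewrite (sub_atoms X XC joinX) in XA.
Qed.
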